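(* Let $F$ be a field, $n\ge 1$, $f\in F[X]$ monic of degree $n$, and $g\in F[X]$. Let $P$ be the set of minimal polynomials of $g$ modulo $r$, as $r$ runs through the monic irreducible factors of $f$. Then the similarity type of $g(C_f)$ is completely determined by $P$ and the degrees of $\gcd(p(g(X)),f),\ \gcd(p^2(g(X)),f),\ \gcd(p^3(g(X)),f),\dots$ for $p\in P$. Explicitly: the set of monic irreducible factors of the minimal polynomial of $g(C_f)$ is $P$; and for $p\in P$, setting $d_0=0$ and $$d_i=\frac{\deg \gcd(p^i(g(X)),f)}{\deg p},\qquad i\ge 1,$$ the multiplicity $b_i$ of $p^i$ as an elementary divisor of $g(C_f)$ is $$b_i=2d_i-d_{i+1}-d_{i-1},\qquad i\ge 1.$$
   Context: For monic $f=f_0+f_1X+\cdots+f_{n-1}X^{n-1}+X^n$ the companion matrix $C_f\in M_n(F)$ has $1$'s on the first subdiagonal, last column $(-f_0,-f_1,\dots,-f_{n-1})^T$, and $0$'s elsewhere. For a monic irreducible $r\in F[X]$, the minimal polynomial of $g$ modulo $r$ is the monic generator of the ideal of all $y\in F[X]$ such that $r$ divides $y(g(X))$. Here $p^i(g(X))=(p(g(X)))^i$, and $\gcd$ denotes the monic greatest common divisor, with $\gcd(0,f)=f$. The elementary divisors of a square matrix $A$ over $F$ are the powers $p^a$ ($p$ monic irreducible, $a\ge1$), listed with multiplicity, such that $A$ is similar to the direct sum of the companion matrices $C_{p^a}$. *)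

(* Defs.v *)
From mathcomp Require Import all_boot all_order all_algebra.
Set Implicit Arguments.
Unset Strict Implicit.
Unset Printing Implicit Defensive.
Import Order.TTheory GRing.Theory Num.Theory.
Local Open Scope ring_scope.

(* MathComp's companionmx has 1s on the superdiagonal and the coefficients in
   the last row; companion is its transpose (companion_tr), with the dimension
   n as an argument so that horner_mx applies when n is a successor. *)
Definition companion (F : fieldType) (n : nat) (f : {poly F}) : 'M[F]_n :=
  \matrix_(i < n, j < n) if j.+1 == n then - f`_i else (i == j.+1 :> nat)%:R.

Lemma companion_tr (F : fieldType) (f : {poly F}) :
  companion (size f).-1 f = (companionmx f)^T.
Proof.
apply/matrixP=> i j; rewrite !mxE; case: (size f).-1 i j => [|n] i j /=.
  by case: i.
by rewrite eqSS eq_sym [i == _ :> nat]eq_sym [n == _]eq_sym.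
Qed.

(* Stated across dimensions because direct sums of companion matrices have a
   dimension only provably equal to that of A; mutually inverse P and Q force
   m = n. *)
Definition mx_similar (F : fieldType) (m n : nat) (A : 'M[F]_m) (B : 'M[F]_n) :=
  exists (P : 'M[F]_(m, n)) (Q : 'M[F]_(n, m)),
    [/\ P *m Q = 1%:M, Q *m P = 1%:M & A = P *m B *m Q].

Lemma mx_similarP (F : fieldType) (n : nat) (A B : 'M[F]_n) :
  mx_similar A B <-> A ~_{in unitmx} B.
Proof.
split=> [[P [Q [PQ QP ->]]]|[P Pu /(simmxP Pu) AB]].
  have [_ Qu] := mulmx1_unit PQ.
  by exists Q => //; apply/(simmxP Qu); rewrite !mulmxA QP mul1mx.
exists (invmx P), P; split; [exact: mulVmx | exact: mulmxV |].
by rewrite -mulmxA -AB mulmxA mulVmx // mul1mx.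
Qed.

Definition monic_irreducible (F : fieldType) (p : {poly F}) :=
  p \is monic /\ irreducible_poly p.

Definition minpoly_mod (F : fieldType) (g r p : {poly F}) :=
  p \is monic /\ forall y : {poly F}, (r %| y \Po g) = (p %| y).

Definition minpoly_set (F : fieldType) (f g p : {poly F}) :=
  exists r : {poly F}, [/\ monic_irreducible r, r %| f & minpoly_mod g r p].

(* gcdp is monic only up to a nonzero constant, which does not affect its
   degree; gcdp 0 f = f. *)
Definition gcd_degree (F : fieldType) (f g p : {poly F}) (i : nat) : nat :=
  (size (gcdp ((p \Po g) ^+ i) f)).-1.

Definition gcd_ratio (F : fieldType) (f g p : {poly F}) (i : nat) : rat :=
  if i == 0%N then 0 else (gcd_degree f g p i)%:R / ((size p).-1)%:R.

Definition companion_sum (F : fieldType) (s : seq {poly F}) :=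
  \mxdiag_(i < size s) companion (size s`_i).-1 s`_i.

Definition elementary_divisors (F : fieldType) (n : nat) (A : 'M[F]_n)
    (s : seq {poly F}) :=
  (forall q : {poly F}, q \in s ->
     exists (p : {poly F}) (a : nat),
       [/\ monic_irreducible p, (0 < a)%N & q = p ^+ a]) /\
  mx_similar A (companion_sum s).

(* Main.v *)
Require Import Defs.
From mathcomp Require Import all_boot all_order all_algebra.
From mathcomp Require Import zify ring.
From Stdlib Require Import Classical.
Set Implicit Arguments.
Unset Strict Implicit.
Unset Printing Implicit Defensive.
Import Order.TTheory GRing.Theory Num.Theory.
Local Open Scope ring_scope.

(** Let C be the companion matrix of f and A = g(C), so that y(A) = (y o g)(C)
    for every polynomial y.

    All numerical information comes from one formula: for a monic q, the kernel
    of h(C_q) has dimension deg gcd(h, q) ([nullity_companion]).  Indeed C_q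
    is multiplication by X on F[X]/(q); by Bezout h may be replaced by
    c = gcd(h, q), and if q = c e then rank c(C_q) >= deg e,
    rank e(C_q) >= deg c, while c(C_q) e(C_q) = 0 bounds the sum of the two
    ranks by deg q.  Applied to q = f it says that p^i(A) has a kernel of
    dimension deg gcd(p^i o g, f) ([gcd_degreeE]).  Applied to the blocks of a
    direct sum of companion matrices of prime powers, it says that the kernel
    dimension of p^i is deg p times the sum of min(i, a) over the blocks p^a;
    its second difference in i is minus deg p times the number of blocks p^i
    ([elementary_divisors_count]).  Comparing the two gives the formula for the
    multiplicities.

    The irreducible p that are minimal polynomials of g modulo an irreducible
    factor of f are exactly those for which p o g is not coprime to f
    ([minpoly_setE]), hence those dividing the minimal polynomial of A
    ([minpoly_setP]); every elementary divisor of A is a power of such a p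
    ([elementary_divisor_minpoly]).  So P and the degrees of the gcds determine
    the elementary divisors up to order, and therefore the similarity type.

    Elementary divisors exist for every square matrix A
    ([elementary_divisors_exist]), by induction on the dimension, splitting off
    one companion block.  Let p be irreducible and p^a its exact power in the
    minimal polynomial p^a q of A.  Some row vector e has
    e q(A)^2 p^(a-1)(A) <> 0, so v = e q(A)^2 has annihilator exactly p^a and
    its first deg p^a Krylov vectors are linearly independent.  Choose a
    column w0 on which they take the values 0, ..., 0, 1, and put
    u = e q(A) and w = q(A) w0.  Then p^a(A) annihilates both u and w, and the
    Hankel matrix (u A^(i+j) w) = (v A^(i+j) w0) is anti-triangular with ones
    on the antidiagonal.  Hence the span of the u A^i and the vectors
    orthogonal to all the A^j w are complementary A-invariant spaces, and A
    acts on the first one through the companion matrix of p^a. *)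

Section ElementaryDivisors.
Variable F : fieldType.
Implicit Types p q r f g h y : {poly F}.

(** * Irreducible polynomials and degrees of gcds *)

Lemma monic_irreducible_gt0 p : monic_irreducible p -> (0 < (size p).-1)%N.
Proof. by case=> _ [sp _]; case: (size p) sp => [|[]]. Qed.

Lemma monic_irreducible_neq0 p : monic_irreducible p -> p != 0.
Proof. by case=> /monic_neq0. Qed.

(** Irreducibility over an arbitrary field is not decidable, hence the
    appeal to excluded middle. *)
Lemma exists_irreducible_factor q :
  (1 < size q)%N -> exists2 p, monic_irreducible p & p %| q.
Proof.
have [n] := ubnP (size q); elim: n q => // n IHn q le_qn q_gt1.
have q0 : q != 0 by rewrite -size_poly_gt0 ltnW.
case: (classic (exists d, [/\ d %| q, size d != 1 & ~~ (d %= q)])).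
  case=> d [dq d1 dNq]; have d0 := dvdpN0 dq q0.
  have lt_dq : (size d < size q)%N.
    by rewrite ltn_neqAle dvdp_leq // andbT dvdp_size_eqp.
  have [||p p_irr pd] := IHn d.
  - exact: leq_trans lt_dq le_qn.
  - by move: d0 d1; rewrite -size_poly_gt0; case: (size d) => [|[]].
  - by exists p => //; exact: dvdp_trans dq.
move=> Nd; have lq0 : (lead_coef q)^-1 != 0 by rewrite invr_eq0 lead_coef_eq0.
exists ((lead_coef q)^-1 *: q); last by rewrite dvdpZl.
split; first by rewrite monicE lead_coefZ mulVf // lead_coef_eq0.
split=> [|d d1]; first by rewrite size_scale.
rewrite dvdpZr // => dq; apply/negPn/negP=> dNq; apply: Nd.
exists d; split=> //.
by apply: contra dNq => dq'; apply: eqp_trans dq' _; rewrite eqp_sym eqp_scale.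
Qed.

Lemma irreducible_dvdM p a b :
  irreducible_poly p -> (p %| a * b) = (p %| a) || (p %| b).
Proof.
move=> p_irr; apply/idP/orP=> [|[]]; first 1 last.
- exact: dvdp_mulr.
- exact: dvdp_mull.
case pa: (p %| a); first by left.
by rewrite Gauss_dvdpr ?irreducible_poly_coprime ?pa //; right.
Qed.

Lemma irreducible_dvdX p a k :
  irreducible_poly p -> p %| a ^+ k -> p %| a.
Proof.
move=> p_irr; elim: k => [|k IHk]; last first.
  by rewrite exprS irreducible_dvdM // => /orP[].
by rewrite expr0 dvdp1; case: p_irr => + _ => /[swap] /eqP ->.
Qed.

Lemma irreducible_factorization p q :
  monic_irreducible p -> q != 0 ->
  exists a t, q = p ^+ a * t /\ ~~ (p %| t).
Proof.
move=> p_irr; have p0 := monic_irreducible_neq0 p_irr.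
have [n] := ubnP (size q); elim: n q => // n IHn q le_qn q0.
case pq: (p %| q); last by exists 0, q; rewrite expr0 mul1r pq.
have [t qE] : exists t : {poly F}, q = t * p by apply/dvdpP.
have t0 : t != 0 by apply: contraNneq q0 => t0; rewrite qE t0 mul0r.
have [|a [u [tE pu]]] := IHn t _ t0.
  move: le_qn; rewrite qE size_mul //; case: p_irr => _ [+ _].
  case: (size p) => [|[|k]] // _; rewrite !addnS /= ltnS.
  exact: leq_ltn_trans (leq_addr _ _).
by exists a.+1, u; rewrite qE tE mulrC exprS mulrA.
Qed.

Lemma monic_irreducible_dvd p r :
  monic_irreducible p -> monic_irreducible r -> p %| r -> p = r.
Proof.
move=> [p_mon [p1 _]] [r_mon [_ r_irr]] pr.
by apply/eqP; rewrite -eqp_monic // r_irr // neq_ltn p1 orbT.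
Qed.

Lemma monic_irreducible_exp_inj p r i a :
  monic_irreducible p -> monic_irreducible r -> (0 < i)%N ->
  p ^+ i = r ^+ a -> p = r /\ i = a.
Proof.
move=> p_irr r_irr i0 E; have pr : p = r.
  apply: monic_irreducible_dvd => //; apply: (@irreducible_dvdX _ _ a).
    by case: p_irr.
  by rewrite -E dvdp_exp.
split=> //; have := congr1 (fun x : {poly F} => (size x).-1) E.
rewrite pr !size_exp => /eqP; rewrite eqn_pmul2l ?monic_irreducible_gt0 //.
by move/eqP.
Qed.

(** The degree of gcd(h, q). *)
Definition gcd_deg h q := (size (gcdp h q)).-1.

Lemma gcd_deg_exp p i a :
  p \is monic -> gcd_deg (p ^+ i) (p ^+ a) = ((size p).-1 * minn i a)%N.
Proof.
move=> p_mon; rewrite /gcd_deg; case: (leqP i a) => [le_ia|/ltnW le_ai].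
  have /eqp_size -> : gcdp (p ^+ i) (p ^+ a) %= p ^+ i.
    by apply: dvdp_gcd_idl; apply: dvdp_exp2l.
  by rewrite size_exp.
have /eqp_size -> : gcdp (p ^+ i) (p ^+ a) %= p ^+ a.
  by apply: dvdp_gcd_idr; apply: dvdp_exp2l.
by rewrite size_exp.
Qed.

Lemma gcd_deg_coprime h q : coprimep h q -> gcd_deg h q = 0.
Proof. by rewrite /gcd_deg coprimep_def => /eqP ->. Qed.

(** For q = r^a, deg gcd(p^i, q) is deg p * min(i, a) if r = p and 0 otherwise,
    and min(i, a) is affine in i except for a bend at i = a.  The identity is
    written without subtraction, which is truncated in nat. *)
Lemma gcd_deg_second_difference p q i :
  monic_irreducible p -> (0 < i)%N ->
  (exists r a, [/\ monic_irreducible r, (0 < a)%N & q = r ^+ a]) ->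
  ((gcd_deg (p ^+ i) q).*2 =
    gcd_deg (p ^+ i.+1) q + gcd_deg (p ^+ i.-1) q
    + (size p).-1 * (q == p ^+ i))%N.
Proof.
move=> p_irr i0 [r [a [r_irr a0 ->]]].
case: (eqVneq p r) => [<-|pNr].
  have -> : (p ^+ a == p ^+ i) = (a == i).
    apply/eqP/eqP=> [/(monic_irreducible_exp_inj p_irr p_irr a0)[]//|->//].
  have p_mon : p \is monic by case: p_irr.
  rewrite !gcd_deg_exp // -!mulnDr -mul2n mulnCA; congr muln.
  by case: eqP; lia.
have cop : coprimep p r.
  rewrite irreducible_poly_coprime; last by case: p_irr.
  by apply: contra pNr => /(monic_irreducible_dvd p_irr r_irr) ->.
have copX j : coprimep (p ^+ j) (r ^+ a).
  by rewrite coprimep_expl // coprimep_expr.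
rewrite !gcd_deg_coprime // eq_sym; case: eqP => [E|_]; last by rewrite muln0.
by case: (monic_irreducible_exp_inj p_irr r_irr i0 E) pNr => ->; rewrite eqxx.
Qed.

(** If p is the minimal polynomial of g modulo an irreducible r, then p is prime
    because F[X]/(r) is a domain.  Conversely, any irreducible r dividing both
    p o g and f has p as minimal polynomial of g, since p lies in the
    proper ideal of all y such that r divides y o g, and generates a maximal
    ideal. *)
Lemma minpoly_setE f g p :
  f != 0 ->
  minpoly_set f g p <-> monic_irreducible p /\ ~~ coprimep (p \Po g) f.
Proof.
move=> f0; split=> [[r [r_irr rf [p_mon pE]]]|[p_irr]].
  have [r_mon r_irr'] := r_irr; have [r1 _] := r_irr'.
  have p0 := monic_neq0 p_mon.
  have Np1 : size p != 1.
    apply/negP=> p1; have := pE 1%:P; rewrite comp_polyC polyC1 => E.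
    have : r %| 1 by rewrite E dvdp1.
    by rewrite dvdp1 gtn_eqF.
  split; last first.
    apply/negP=> /coprimepP/(_ r); rewrite pE dvdpp rf => /(_ isT isT).
    by rewrite -size_poly_eq1 gtn_eqF.
  split=> //; split=> [|q q1 /dvdpP[t pE']].
    by move: p0 Np1; rewrite -size_poly_gt0; case: (size p) => [|[]].
  have [q0 t0] : q != 0 /\ t != 0.
    by move: p0; rewrite pE' mulf_eq0 negb_or => /andP[].
  have : p %| t * q by rewrite -pE'.
  rewrite -pE comp_polyM irreducible_dvdM // !pE => /orP[pt|pq].
    have := dvdp_leq t0 pt; rewrite pE' size_mul // => le_t; case/negP: q1.
    by move: q0; rewrite -size_poly_gt0 => q0; apply/eqP; lia.
  by rewrite /eqp pq pE' dvdp_mulIr.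
rewrite coprimep_def => gcd1.
have [|r r_irr] := @exists_irreducible_factor (gcdp (p \Po g) f).
  have : gcdp (p \Po g) f != 0 by rewrite gcdp_eq0 negb_and f0 orbT.
  by move: gcd1; rewrite -size_poly_gt0; case: size => [|[]].
rewrite dvdp_gcd => /andP[rpg rf]; exists r; split=> //; split=> [|y].
  by case: p_irr.
apply/idP/idP=> [ryg|]; last first.
  by move/(dvdp_comp_poly g); apply: dvdp_trans.
apply/negPn/negP; rewrite -irreducible_poly_coprime; last by case: p_irr.
case/Bezout_eq1_coprimepP=> -[u v] /= /(congr1 (comp_poly g)).
rewrite comp_polyD !comp_polyM -{1}polyC1 comp_polyC polyC1 => E.
have : r %| 1 by rewrite -E dvdp_add // dvdp_mull.
by case: r_irr => _ [r1 _]; rewrite dvdp1 gtn_eqF.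
Qed.

(** * Evaluation of polynomials at matrices, and similarity *)

(** p(A) in every dimension: [horner_mx] needs a nonzero dimension, whereas the
    blocks of a direct sum may have dimension 0.  In a nonzero dimension the two
    are convertible. *)
Definition mxeval (n : nat) : 'M[F]_n -> {poly F} -> 'M[F]_n :=
  match n with
  | 0 => fun A _ => A
  | n'.+1 => fun A p => horner_mx A p
  end.

Lemma mxevalD n (A : 'M_n) p q : mxeval A (p + q) = mxeval A p + mxeval A q.
Proof.
case: n A => [|n] A /=; first by rewrite [LHS]flatmx0 [RHS]flatmx0.
by rewrite rmorphD.
Qed.

Lemma mxevalM n (A : 'M_n) p q : mxeval A (p * q) = mxeval A p *m mxeval A q.
Proof.
case: n A => [|n] A /=; first by rewrite [LHS]flatmx0 [RHS]flatmx0.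
by rewrite rmorphM.
Qed.

Lemma mxevalZ n (A : 'M_n) c p : mxeval A (c *: p) = c *: mxeval A p.
Proof.
case: n A => [|n] A /=; first by rewrite [LHS]flatmx0 [RHS]flatmx0.
by rewrite linearZ.
Qed.

Lemma mxevalC n (A : 'M_n) c : mxeval A c%:P = c%:M.
Proof.
case: n A => [|n] A /=; first by rewrite [LHS]flatmx0 [RHS]flatmx0.
by rewrite horner_mx_C.
Qed.

Lemma mxevalX n (A : 'M_n) : mxeval A 'X = A.
Proof. by case: n A => [|n] A //=; rewrite horner_mx_X. Qed.

Lemma mxeval0 n (A : 'M_n) : mxeval A 0 = 0.
Proof. by rewrite -polyC0 mxevalC raddf0. Qed.

Lemma mxeval1 n (A : 'M_n) : mxeval A 1 = 1%:M.
Proof. by rewrite -polyC1 mxevalC. Qed.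

Lemma mxeval_sum n (A : 'M_n) I (s : seq I) (E : I -> {poly F}) :
  mxeval A (\sum_(i <- s) E i) = \sum_(i <- s) mxeval A (E i).
Proof. by apply: big_morph => [p q|]; [exact: mxevalD | exact: mxeval0]. Qed.

Lemma mxeval_comm n (A : 'M_n) p q :
  mxeval A p *m mxeval A q = mxeval A q *m mxeval A p.
Proof. by rewrite -!mxevalM mulrC. Qed.

Lemma mxeval_tr n (A : 'M_n) p : mxeval A^T p = (mxeval A p)^T.
Proof.
elim/poly_ind: p => [|p c IHp]; first by rewrite !mxeval0 trmx0.
have AC := mxeval_comm A 'X p; rewrite mxevalX in AC.
rewrite !mxevalD !mxevalM !mxevalC !mxevalX IHp linearD /= tr_scalar_mx.
by rewrite -trmx_mul AC.
Qed.

Lemma mxeval_comp n (A : 'M_n) p g : mxeval A (p \Po g) = mxeval (mxeval A g) p.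
Proof.
elim/poly_ind: p => [|p c IHp]; first by rewrite comp_poly0 !mxeval0.
rewrite comp_polyD comp_polyM comp_polyC comp_polyX.
by rewrite !mxevalD !mxevalM !mxevalC mxevalX IHp.
Qed.

Lemma mxeval_intertwine m n (A : 'M_m) (B : 'M_n) (P : 'M_(m, n)) p :
  A *m P = P *m B -> mxeval A p *m P = P *m mxeval B p.
Proof.
move=> AP; elim/poly_ind: p => [|p c IHp].
  by rewrite !mxeval0 mul0mx mulmx0.
rewrite !mxevalD !mxevalM !mxevalC !mxevalX mulmxDl mulmxDr.
by rewrite -mulmxA AP !mulmxA IHp mul_scalar_mx mul_mx_scalar.
Qed.

Lemma mxeval_block m n (A : 'M_m) (B : 'M_n) p :
  mxeval (block_mx A 0 0 B) p = block_mx (mxeval A p) 0 0 (mxeval B p).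
Proof.
elim/poly_ind: p => [|p c IHp].
  by rewrite !mxeval0; apply/esym/(block_mx0 _ _ _ _ _).
rewrite !mxevalD !mxevalM !mxevalC !mxevalX IHp mulmx_block.
by rewrite (scalar_mx_block m n c) add_block_mx !(mulmx0, mul0mx, addr0, add0r).
Qed.

(** The dimension of the kernel of p(A). *)
Definition nullity n (A : 'M[F]_n) p := \rank (kermx (mxeval A p)).

Lemma nullity_block m n (A : 'M_m) (B : 'M_n) p :
  nullity (block_mx A 0 0 B) p = (nullity A p + nullity B p)%N.
Proof.
rewrite /nullity !mxrank_ker mxeval_block rank_diag_block_mx.
by have := rank_leq_row (mxeval A p); have := rank_leq_row (mxeval B p); lia.
Qed.

Lemma mx_similar_refl n (A : 'M[F]_n) : mx_similar A A.
Proof. by exists 1%:M, 1%:M; rewrite !mulmx1 mul1mx. Qed.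

Lemma mx_similar_sym m n (A : 'M[F]_m) (B : 'M[F]_n) :
  mx_similar A B -> mx_similar B A.
Proof.
case=> P [Q [PQ QP ->]]; exists Q, P.
by rewrite !mulmxA QP mul1mx -mulmxA QP mulmx1.
Qed.

Lemma mx_similar_trans m n k (A : 'M[F]_m) (B : 'M[F]_n) (C : 'M[F]_k) :
  mx_similar A B -> mx_similar B C -> mx_similar A C.
Proof.
case=> P [Q [PQ QP ->]] [P' [Q' [PQ' QP' ->]]]; exists (P *m P'), (Q' *m Q).
split; last by rewrite !mulmxA.
  by rewrite mulmxA -(mulmxA P) PQ' mulmx1.
by rewrite mulmxA -(mulmxA Q') QP mulmx1.
Qed.

Lemma mx_similar_dim m n (A : 'M[F]_m) (B : 'M[F]_n) : mx_similar A B -> m = n.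
Proof.
case=> P [Q [PQ QP _]]; apply/eqP; rewrite eqn_leq; apply/andP; split.
  by rewrite -(mxrank1 F m) -PQ (leq_trans (mxrankM_maxl _ _)) // rank_leq_col.
by rewrite -(mxrank1 F n) -QP (leq_trans (mxrankM_maxl _ _)) // rank_leq_col.
Qed.

Lemma mx_similar_nullity m n (A : 'M[F]_m) (B : 'M[F]_n) p :
  mx_similar A B -> nullity A p = nullity B p.
Proof.
move=> AB; have mn := mx_similar_dim AB; case: AB => P [Q [PQ QP AE]].
have APB : mxeval A p *m P = P *m mxeval B p.
  by apply: mxeval_intertwine; rewrite AE -!mulmxA QP mulmx1.
rewrite /nullity !mxrank_ker; congr (_ - _)%N; first exact: mn.
apply/eqP; rewrite eqn_leq; apply/andP; split.
  have -> : mxeval A p = P *m mxeval B p *m Q by rewrite -APB -mulmxA PQ mulmx1.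
  by rewrite (leq_trans (mxrankM_maxl _ _)) // mxrankM_maxr.
have -> : mxeval B p = Q *m (mxeval A p *m P) by rewrite APB mulmxA QP mul1mx.
by rewrite (leq_trans (mxrankM_maxr _ _)) // mxrankM_maxl.
Qed.

Lemma mx_similar_block m m' n n' (A : 'M[F]_m) (A' : 'M[F]_m')
    (B : 'M[F]_n) (B' : 'M[F]_n') :
  mx_similar A A' -> mx_similar B B' ->
  mx_similar (block_mx A 0 0 B) (block_mx A' 0 0 B').
Proof.
case=> P [Q [PQ QP ->]] [P' [Q' [PQ' QP' ->]]].
exists (block_mx P 0 0 P'), (block_mx Q 0 0 Q').
by rewrite !mulmx_block !(mulmx0, mul0mx, addr0, add0r) PQ QP PQ' QP'
  -!scalar_mx_block.
Qed.

(** Blocks on the diagonal can be permuted; the change of basis exchanges the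
    first two summands. *)
Lemma mx_similar_blockCA m n k (A : 'M[F]_m) (B : 'M[F]_n) (C : 'M[F]_k) :
  mx_similar (block_mx A 0 0 (block_mx B 0 0 C))
    (block_mx B 0 0 (block_mx A 0 0 C)).
Proof.
exists (block_mx 0 (row_mx 1%:M 0) (col_mx 1%:M 0) (block_mx 0 0 0 1%:M)).
exists (block_mx 0 (row_mx 1%:M 0) (col_mx 1%:M 0) (block_mx 0 0 0 1%:M)).
split; rewrite !mulmx_block !(mul_row_col, mul_col_row, mulmx0, mul0mx, addr0,
  add0r, mul_row_block, mul_block_col, mul_mx_row, mul_col_mx, mulmx1, mul1mx,
  row_mx0, col_mx0) ?add_block_mx ?(addr0, add0r) -?scalar_mx_block //.
congr block_mx; apply/matrixP=> i j; rewrite !mxE.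
by case Ei: (split i) => [i'|i']; case Ej: (split j) => [j'|j'];
  rewrite !(mxE, Ei, Ej) ?addr0 ?add0r.
Qed.

(** The two sides have dimensions that are only provably equal; similarity does
    not see the cast. *)
Lemma companion_sum_cons q (s : seq {poly F}) :
  mx_similar (companion_sum (q :: s))
    (block_mx (companion (size q).-1 q) 0 0 (companion_sum s)).
Proof.
rewrite /companion_sum mxdiag_recl.
have cast_sim k l (e : k = l) (A : 'M[F]_k) : mx_similar (castmx (e, e) A) A.
  by case: _ / e; rewrite castmx_id; exact: mx_similar_refl.
exact: cast_sim.
Qed.

Lemma companion_sum_rem p (s : seq {poly F}) :
  p \in s -> mx_similar (companion_sum s) (companion_sum (p :: rem p s)).
Proof.
elim: s => [|q s IHs] //; rewrite inE eq_sym /=.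
case: eqP => [-> _|_ /= /IHs{}IHs]; first exact: mx_similar_refl.
apply: mx_similar_trans (companion_sum_cons _ _) _.
apply: mx_similar_trans (mx_similar_block (mx_similar_refl _) IHs) _.
apply: mx_similar_trans
  (mx_similar_block (mx_similar_refl _) (companion_sum_cons _ _)) _.
apply: mx_similar_trans (mx_similar_blockCA _ _ _) _.
apply: mx_similar_trans _
  (mx_similar_sym (companion_sum_cons p (q :: rem p s))).
apply: mx_similar_block (mx_similar_refl _) _.
exact: mx_similar_sym (companion_sum_cons _ _).
Qed.

Lemma companion_sum_perm (s t : seq {poly F}) :
  perm_eq s t -> mx_similar (companion_sum s) (companion_sum t).
Proof.
elim: s t => [|x s IHs] t st.
  by move: st; rewrite perm_sym => /perm_nilP ->; exact: mx_similar_refl.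
have xt : x \in t by rewrite -(perm_mem st) mem_head.
apply: mx_similar_trans _ (mx_similar_sym (companion_sum_rem xt)).
apply: mx_similar_trans (companion_sum_cons _ _) _.
apply: mx_similar_trans _ (mx_similar_sym (companion_sum_cons x (rem x t))).
apply: mx_similar_block (mx_similar_refl _) (IHs _ _).
by rewrite -(perm_cons x) (perm_trans st) // perm_to_rem.
Qed.

(** * Krylov matrices and the kernel dimension of h(C_q) *)

(** The rows v, v A, ..., v A^(d-1). *)
Definition krylov d n (A : 'M[F]_n) (v : 'rV[F]_n) : 'M[F]_(d, n) :=
  \matrix_(i < d) (v *m mxeval A 'X^i).

(** A combination of Krylov vectors is the action of a polynomial. *)
Lemma mul_krylov d n (A : 'M[F]_n) v (x : 'rV_d) :
  x *m krylov d A v = v *m mxeval A (rVpoly x).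
Proof.
rewrite mulmx_sum_row [rVpoly x]poly_def mxeval_sum mulmx_sumr.
apply: eq_bigr => i _; rewrite rowK mxevalZ scalemxAr; congr (_ *m (_ *: _)).
by rewrite -coef_rVpoly coef_rVpoly_ord.
Qed.

(** The ideal of polynomials y with v y(A) = 0 is generated by q. *)
Definition annihilator n (A : 'M[F]_n) (v : 'rV_n) q :=
  forall y, (v *m mxeval A y == 0) = (q %| y).

Lemma krylov_free n (A : 'M[F]_n) v q :
  q != 0 -> annihilator A v q -> row_free (krylov (size q).-1 A v).
Proof.
move=> q0 ann; apply: inj_row_free => x; rewrite mul_krylov => /eqP.
rewrite ann => qx; apply: (can_inj rVpolyK); rewrite linear0.
apply: contraTeq qx => x0.
apply: contraTN (size_poly _ _ : (size (rVpoly x) <= _)%N).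
move/(dvdp_leq x0); rewrite -ltnNge; apply: leq_trans.
by rewrite prednK // size_poly_gt0.
Qed.

Lemma row_companion_tr d q (i : 'I_d) (lt_id : (i.+1 < d)%N) :
  row i (companion d q)^T = delta_mx 0 (Ordinal lt_id).
Proof. by apply/rowP=> j; rewrite !mxE ltn_eqF. Qed.

Lemma mxeval_char_poly n (A : 'M[F]_n) : mxeval A (char_poly A) = 0.
Proof. by case: n A => [|n] A; [exact: flatmx0 | exact: Cayley_Hamilton]. Qed.

Lemma companion_root q : q \is monic ->
  mxeval (companion (size q).-1 q) q = 0.
Proof.
move=> q_mon; rewrite -[companion _ _]trmxK mxeval_tr companion_tr trmxK.
apply/eqP; rewrite trmx_eq0; apply/eqP.
have := mxeval_char_poly (companionmx q); rewrite companionmxK //.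
Qed.

(** If q(A) kills v, then A acts on the Krylov vectors of v, written as rows,
    through the transpose of the companion matrix of q. *)
Lemma krylov_companion d n (A : 'M[F]_n) (v : 'rV_n) q :
  q \is monic -> d = (size q).-1 -> v *m mxeval A q = 0 ->
  krylov d A v *m A = (companion d q)^T *m krylov d A v.
Proof.
move=> q_mon dE vq; apply/row_matrixP=> i; rewrite !row_mul rowK.
rewrite mul_krylov -{2}[A]mxevalX -mulmxA -mxevalM -exprSr.
apply/eqP; rewrite -subr_eq0 -mulmxBr; set B := (X in _ *m X).
have -> : B = mxeval A ('X^(i.+1) - rVpoly (row i (companion d q)^T)).
  by rewrite /B -scaleN1r -mxevalZ -mxevalD scaleN1r.
(* This polynomial is 0 unless i is the last row, where it is q. *)
case: (ltnP i.+1 d) => [lt_id|le_di].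
  by rewrite row_companion_tr rVpoly_delta subrr mxeval0 mulmx0.
suff -> : 'X^(i.+1) - rVpoly (row i (companion d q)^T) = q by rewrite vq.
have iE : i.+1 = d by apply/eqP; rewrite eqn_leq ltn_ord.
apply/polyP=> j; rewrite coefB coefXn coef_rVpoly iE; case: insubP => [k _ kj|].
  by rewrite !mxE iE eqxx opprK -kj (ltn_eqF (ltn_ord k)) add0r.
move=> jd; have {jd}: (d <= j)%N by rewrite leqNgt.
rewrite subr0 leq_eqVlt => /predU1P[<-|lt_dj].
  by rewrite eqxx dE; move/monicP: q_mon.
rewrite gtn_eqF // nth_default //; move: lt_dj; rewrite dE.
by case: (size q).
Qed.

Lemma krylov_companion_delta d q (d0 : (0 < d)%N) :
  krylov d (companion d q)^T (delta_mx 0 (Ordinal d0)) = 1%:M.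
Proof.
apply/row_matrixP=> i; rewrite rowK rowE mulmx1.
case: i => i; elim: i => [|i IHi] lt_id /=.
  by rewrite mxeval1 mulmx1; congr delta_mx; apply: val_inj.
rewrite exprSr mxevalM mulmxA (IHi (ltnW lt_id)) mxevalX -rowE.
exact: row_companion_tr.
Qed.

(** The first unit vector is a cyclic vector for the transposed companion
    matrix; in dimension 0 the zero vector is. *)
Lemma companion_cyclic q : q \is monic ->
  exists v, annihilator (companion (size q).-1 q)^T v q.
Proof.
move=> q_mon; set d := (size q).-1; set A := _^T.
have A_root : mxeval A q = 0 by rewrite mxeval_tr companion_root // trmx0.
case: (posnP d) => [d0|d0].
  exists 0 => y; rewrite mul0mx eqxx; apply/esym.
  suff /eqP -> : q == 1 by rewrite dvd1p.
  rewrite -eqp_monic ?monic1 // -size_poly_eq1; move: d0 (monic_neq0 q_mon).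
  by rewrite /d -size_poly_gt0; case: (size q) => [|[]].
exists (delta_mx 0 (Ordinal d0)) => y.
rewrite {1}(divp_eq y q) mxevalD mxevalM A_root mulmx0 add0r.
have r_small : (size (y %% q)%R <= d)%N.
  by rewrite -ltnS /d prednK ?ltn_modp ?size_poly_gt0 monic_neq0.
rewrite -(poly_rV_K r_small) -mul_krylov krylov_companion_delta mulmx1.
apply/eqP/idP=> [r0|/modp_eq0P ->]; last exact: linear0.
by apply/modp_eq0P; rewrite -(poly_rV_K r_small) r0 linear0.
Qed.

Lemma companion_dvd n q y : q \is monic -> (size q).-1 = n ->
  (mxeval (companion n q) y == 0) = (q %| y).
Proof.
move=> q_mon <-; have [v ann] := companion_cyclic q_mon.
apply/idP/idP=> [y0|/dvdpP[t ->]]; last first.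
  by rewrite mxevalM companion_root // mulmx0.
by rewrite -ann mxeval_tr (eqP y0) trmx0 mulmx0.
Qed.

(** The vector v c(A) has annihilator e, and its deg e independent Krylov
    vectors all lie in the row space of c(A). *)
Lemma rank_mxeval_ge n (A : 'M[F]_n) v c e :
  c * e != 0 -> annihilator A v (c * e) ->
  ((size e).-1 <= \rank (mxeval A c))%N.
Proof.
move=> ce0 ann; have [c0 e0] : c != 0 /\ e != 0.
  by move: ce0; rewrite mulf_eq0 negb_or => /andP[].
have ann' : annihilator A (v *m mxeval A c) e.
  by move=> y; rewrite -mulmxA -mxevalM ann dvdp_mul2l.
have /eqP <- := krylov_free e0 ann'; apply: mxrankS; apply/row_subP=> i.
by rewrite rowK -mulmxA mxeval_comm mulmxA submxMl.
Qed.

Lemma nullity_companion q h : q \is monic ->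
  nullity (companion (size q).-1 q) h = gcd_deg h q.
Proof.
move=> q_mon; set d := (size q).-1; set A := companion _ _.
have q0 := monic_neq0 q_mon.
have [v ann] := companion_cyclic q_mon.
(* Ranks are computed on the transpose, which has a cyclic row vector. *)
rewrite /nullity mxrank_ker -mxrank_tr -mxeval_tr -/A.
set c := gcdp h q.
have /dvdpP[e qE] : c %| q by exact: dvdp_gcdr.
have /dvdpP[h' hE] : c %| h by exact: dvdp_gcdl.
have c0 : c != 0 by rewrite gcdp_eq0 negb_and q0 orbT.
have e0 : e != 0 by apply: contraNneq q0 => e0; rewrite qE e0 mul0r.
have A_root : mxeval A^T q = 0 by rewrite mxeval_tr companion_root // trmx0.
have rhc : \rank (mxeval A^T h) = \rank (mxeval A^T c).
  apply/eqP; rewrite eqn_leq; apply/andP; split.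
    by rewrite hE mxevalM mxrankM_maxr.
  have [[u w] /= /andP[/dvdpP[t tE] _]] := Bezoutp h q.
  rewrite -/c in tE; rewrite tE.
  rewrite mxevalM mxevalD !mxevalM A_root mulmx0 addr0 mulmxA.
  exact: mxrankM_maxr.
have le_e : ((size e).-1 <= \rank (mxeval A^T c))%N.
  by apply: (@rank_mxeval_ge _ _ v); rewrite mulrC -qE.
have le_c : ((size c).-1 <= \rank (mxeval A^T e))%N.
  by apply: (@rank_mxeval_ge _ _ v); rewrite -qE.
have le_d : (\rank (mxeval A^T c) + \rank (mxeval A^T e) <= d)%N.
  by apply: mulmx0_rank_max; rewrite -mxevalM mulrC -qE.
have dE : (d = (size c).-1 + (size e).-1)%N.
  rewrite /d qE size_mul //; move: e0 c0; rewrite -!size_poly_gt0.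
  by case: (size e) => // k _; case: (size c) => // l _; rewrite addnS /= addnC.
rewrite rhc /gcd_deg -/c -/d.
by move: (\rank _) (\rank _) le_e le_c le_d => a b; lia.
Qed.

(** * Existence of elementary divisors *)

(** The row space of U and the left kernel of W are A-invariant and, because
    U W is invertible, complementary.  With L = (U W)^-1 U, the relation L A = C L
    follows from U A = C^T U and C^T (U W) = U A W = (U W) C. *)
Lemma split_block d n (A : 'M[F]_n) (C : 'M_d) (U : 'M_(d, n)) (W : 'M_(n, d)) :
  U *m A = C^T *m U -> A *m W = W *m C -> U *m W \in unitmx ->
  exists m (B : 'M_m), mx_similar A (block_mx C 0 0 B).
Proof.
move=> UA AW Hu; set H := U *m W in Hu.
have HC : invmx H *m C^T = C *m invmx H.
  apply: (can_inj (mulKmx Hu)); apply: (can_inj (mulmxK Hu)).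
  by rewrite mulKVmx // (mulmxA H C) mulmxKV // /H mulmxA -UA -!mulmxA AW.
pose L := invmx H *m U; pose K := row_base (kermx W).
have LW : L *m W = 1%:M by rewrite -mulmxA mulVmx.
have LA : L *m A = C *m L by rewrite -mulmxA UA !mulmxA HC.
have KW : K *m W = 0 by apply/sub_kermxP; rewrite eq_row_base.
have K_free : row_free K by exact: row_base_free.
have /submxP[B KA] : (K *m A <= K)%MS.
  by rewrite eq_row_base; apply/sub_kermxP; rewrite -mulmxA AW mulmxA KW mul0mx.
pose Q := col_mx L K; exists (\rank (kermx W)), B.
have Q_free : row_free Q.
  apply: inj_row_free => x; rewrite -(hsubmxK x) mul_row_col => xQ.
  have x1 : lsubmx x = 0.
    have := congr1 (mulmxr W) xQ.
    rewrite /= mulmxDl -(mulmxA _ L) -(mulmxA _ K) LW KW.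
    by rewrite mulmx1 mulmx0 addr0 mul0mx.
  have x2 : rsubmx x = 0.
    by apply: (row_free_inj K_free); rewrite mul0mx -xQ x1 mul0mx add0r.
  by rewrite x1 x2 row_mx0.
have rW : \rank W = d.
  apply/eqP; rewrite eqn_leq rank_leq_col -{1}(mxrank1 F d) -LW.
  exact: mxrankM_maxr.
have Q_full : row_full Q.
  rewrite /row_full (eqP Q_free) mxrank_ker rW subnKC // -{1}rW.
  exact: rank_leq_row.
have /row_freeP[P QP] := Q_free; have /row_fullP[P' P'Q] := Q_full.
have PP' : P' = P by rewrite -[LHS]mulmx1 -QP mulmxA P'Q mul1mx.
rewrite PP' in P'Q; exists P, Q; split=> //.
rewrite -mulmxA mul_block_col !mul0mx addr0 add0r -LA -KA -mul_col_mx.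
by rewrite mulmxA P'Q mul1mx.
Qed.

(** The last hypothesis says that y |-> u y(A) w is the coefficient of degree
    d - 1 on polynomials of degree less than d = deg q; it makes the Hankel
    matrix (u A^(i+j) w) anti-triangular with ones on the antidiagonal. *)
Lemma cyclic_split n (A : 'M[F]_n) q (u : 'rV_n) (w : 'cV_n) :
  q \is monic -> u *m mxeval A q = 0 -> mxeval A q *m w = 0 ->
  (forall y, (size y <= (size q).-1)%N ->
     u *m mxeval A y *m w = (y`_(size q).-2)%:M) ->
  exists m (B : 'M_m), mx_similar A (block_mx (companion (size q).-1 q) 0 0 B).
Proof.
move=> q_mon uq qw uw; set d := (size q).-1.
have UA := krylov_companion q_mon (erefl d) uq.
have wq : w^T *m mxeval A^T q = 0 by rewrite mxeval_tr -trmx_mul qw trmx0.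
have WA := krylov_companion q_mon (erefl d) wq.
apply: (@split_block _ _ _ _ (krylov d A u) (krylov d A^T w^T)^T) => //.
  by rewrite -[LHS]trmxK trmx_mul trmxK WA trmx_mul trmxK.
rewrite -row_free_unit; apply: inj_row_free => x.
rewrite mulmxA mul_krylov => xW; apply: (can_inj rVpolyK); rewrite linear0.
apply/eqP/negPn/negP=> X0; set X := rVpoly x in xW X0.
have le_Xd : (size X <= d)%N by exact: size_poly.
have X_gt0 : (0 < size X)%N by rewrite size_poly_gt0.
(* X * 'X^(d - size X) has degree d - 1, so this column of the Hankel matrix
   sends x to the leading coefficient of X. *)
have lt_jd : (d - size X < d)%N by lia.
have := congr1 (mulmxr (delta_mx (Ordinal lt_jd) (0 : 'I_1))) xW.
rewrite /= -mulmxA -colE mul0mx -tr_row rowK trmx_mul trmxK mxeval_tr trmxK /=.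
rewrite mulmxA -(mulmxA u) -mxevalM uw; last by rewrite size_mulXn ?subnK.
have dE : ((size q).-2 = d - size X + (size X).-1)%N.
  by rewrite -[LHS]/d.-1; lia.
move/matrixP/(_ 0 0)/eqP; rewrite !mxE eqxx mulr1n.
rewrite coefMXn dE ltnNge leq_addr addKn.
by rewrite -lead_coefE lead_coef_eq0 (negbTE X0).
Qed.

(** A companion block of a prime power splits off any matrix of positive
    dimension. *)
Lemma elementary_divisors_step n (A : 'M[F]_n.+1) :
  exists p a m (B : 'M[F]_m), [/\ monic_irreducible p, (0 < a)%N &
    mx_similar A (block_mx (companion (size (p ^+ a)).-1 (p ^+ a)) 0 0 B)].
Proof.
have mu_mon := mxminpoly_monic A; have mu0 := monic_neq0 mu_mon.
have [|p p_irr p_mu] := @exists_irreducible_factor (mxminpoly A).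
  by rewrite size_mxminpoly ltnS mxminpoly_nonconstant.
have [p_mon p_irr'] := p_irr.
have [a [q [muE pNq]]] := irreducible_factorization p_irr mu0.
have a0 : (0 < a)%N.
  by case: a muE => // muE; move: pNq; rewrite -[q]mul1r -(expr0 p) -muE p_mu.
exists p, a.
have pa_root : mxeval A (q * p ^+ a) = 0.
  by rewrite mulrC -muE; exact: mx_root_minpoly.
pose N := mxeval A (q * q * p ^+ a.-1).
have [i Ni] : exists i, row i N != 0.
  apply/existsP; rewrite -negb_forall; apply/negP=> /forallP N0.
  have : mxminpoly A %| q * q * p ^+ a.-1.
    rewrite dvd_mxminpoly; apply/eqP/row_matrixP=> i; rewrite row0.
    exact/eqP.
  (* p^a q | q^2 p^(a-1) would force p | q. *)
  rewrite muE -{1}(prednK a0) exprS -mulrA -mulrA [q * p ^+ _]mulrC.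
  have q0 : q != 0 by apply: contraNneq pNq => ->; exact: dvdp0.
  have paq0 : p ^+ a.-1 * q != 0.
    by rewrite mulf_neq0 // expf_neq0 // monic_neq0.
  by rewrite dvdp_mul2r // (negbTE pNq).
pose v : 'rV_n.+1 := delta_mx 0 i *m mxeval A (q * q).
have v_ideal s y t :
    v *m mxeval A y = 0 -> v *m mxeval A (s * y + t * p ^+ a) = 0.
  move=> vy; rewrite mxevalD mulmxDr [s * y]mulrC.
  rewrite (mxevalM A y s) (mulmxA v) vy mul0mx add0r.
  rewrite -mulmxA -mxevalM (_ : _ * _ = q * p ^+ a * (q * t)); last by ring.
  by rewrite mxevalM pa_root mul0mx mulmx0.
have ann : annihilator A v (p ^+ a).
  move=> y; apply/eqP/idP=> [vy|/dvdpP[t ->]]; last first.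
    by have := v_ideal 0 0 t; rewrite mxeval0 mulmx0 mul0r add0r; apply.
  have [->|y0] := eqVneq y 0; first exact: dvdp0.
  have [b [z [yE pNz]]] := irreducible_factorization p_irr y0.
  have [le_ab|lt_ba] := leqP a b; first by rewrite yE dvdp_mulr // dvdp_exp2l.
  have : coprimep z (p ^+ a).
    by rewrite coprimep_sym coprimep_expl // irreducible_poly_coprime.
  case/Bezout_eq1_coprimepP=> -[s t] /= stE; case/negP: Ni; apply/eqP.
  rewrite rowE [N]mxevalM mulmxA -/v.
  (* If b < a, Bezout for z and p^a puts p^(a-1) in the ideal generated by y
     and p^a. *)
  have -> : p ^+ a.-1 = (p ^+ (a.-1 - b) * s) * y + (p ^+ a.-1 * t) * p ^+ a.
    rewrite -[LHS]mulr1 -stE mulrDr yE -{1}(@subnK b a.-1) ?exprD; last by lia.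
    by ring.
  exact: v_ideal.
pose d := (size (p ^+ a)).-1.
have d0 : (0 < d)%N by rewrite /d size_exp muln_gt0 monic_irreducible_gt0.
have d2 : ((size (p ^+ a)).-2 < d)%N by rewrite prednK.
have pa_mon : p ^+ a \is monic by exact: monic_exp.
have /row_freeP[R KR] := krylov_free (monic_neq0 pa_mon) ann.
(* w0 takes the value 1 on the last Krylov vector of v and 0 on the others. *)
pose w0 : 'cV_n.+1 := R *m delta_mx (Ordinal d2) 0.
pose u : 'rV_n.+1 := delta_mx 0 i *m mxeval A q.
have [||||m [B AB]] := @cyclic_split _ A (p ^+ a) u (mxeval A q *m w0);
  last by exists m, B.
- exact: pa_mon.
- by rewrite /u -mulmxA -mxevalM pa_root mulmx0.
- by rewrite mulmxA -mxevalM mulrC pa_root mul0mx.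
move=> y le_yd.
have -> : u *m mxeval A y *m (mxeval A q *m w0) = v *m mxeval A y *m w0.
  rewrite mulmxA; congr (_ *m w0); rewrite /u /v -!mulmxA -!mxevalM.
  by congr (_ *m mxeval A _); ring.
rewrite -{1}(poly_rV_K le_yd) -mul_krylov.
rewrite -mulmxA [krylov _ _ _ *m _]mulmxA KR mul1mx -colE.
by apply/matrixP=> k l; rewrite !mxE !ord1 eqxx mulr1n.
Qed.

Lemma elementary_divisors_exist n (A : 'M[F]_n) :
  exists s, elementary_divisors A s.
Proof.
have [k] := ubnP n; elim: k n A => // k IHk [|n] A le_nk.
  exists [::]; split=> //; exists 0, 0.
  by split; apply/matrixP=> i; exfalso; have := ltn_ord i;
    rewrite ?[X in (_ < X)%N]big_ord0.
have [p [a [m [B [p_irr a0 AB]]]]] := elementary_divisors_step A.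
have mE := mx_similar_dim AB.
have [|s [s_irr Bs]] := IHk m B.
  have : (0 < (size (p ^+ a)).-1)%N.
    by rewrite size_exp muln_gt0 monic_irreducible_gt0.
  by lia.
exists (p ^+ a :: s); split=> [q|].
  by rewrite inE => /predU1P[->|/s_irr//]; exists p, a.
apply: mx_similar_trans AB _.
apply: mx_similar_trans _ (mx_similar_sym (companion_sum_cons (p ^+ a) s)).
exact: mx_similar_block (mx_similar_refl _) Bs.
Qed.

(** * Elementary divisors and kernel dimensions *)

Lemma nullity_companion_sum (s : seq {poly F}) h :
  (forall q, q \in s -> q \is monic) ->
  nullity (companion_sum s) h = (\sum_(q <- s) gcd_deg h q)%N.
Proof.
elim: s => [_|q s IHs s_mon].
  apply/eqP; rewrite big_nil -leqn0 (leq_trans (rank_leq_row _)) //.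
  by rewrite [X in (X <= _)%N]big_ord0.
rewrite (mx_similar_nullity _ (companion_sum_cons q s)) nullity_block big_cons.
rewrite nullity_companion ?s_mon ?mem_head // IHs // => r rs.
by rewrite s_mon // inE rs orbT.
Qed.

Lemma elementary_divisors_nullity n (A : 'M[F]_n) s h :
  elementary_divisors A s -> nullity A h = (\sum_(q <- s) gcd_deg h q)%N.
Proof.
case=> s_irr As; rewrite (mx_similar_nullity _ As) nullity_companion_sum // => q.
by case/s_irr=> p [a [[p_mon _] _ ->]]; exact: monic_exp.
Qed.

(** Multiplicities of elementary divisors as second differences of kernel
    dimensions. *)
Lemma elementary_divisors_count n (A : 'M[F]_n) s p i :
  elementary_divisors A s -> monic_irreducible p -> (0 < i)%N ->
  ((nullity A (p ^+ i)).*2 =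
    nullity A (p ^+ i.+1) + nullity A (p ^+ i.-1)
    + (size p).-1 * count_mem (p ^+ i) s)%N.
Proof.
move=> As p_irr i0; rewrite !(elementary_divisors_nullity _ As).
have [s_irr _] := As.
have -> : count_mem (p ^+ i) s = (\sum_(q <- s) (q == p ^+ i))%N.
  by rewrite -sum1_count big_mkcond; apply: eq_bigr => q _ /=; case: eqP.
rewrite -muln2 big_distrl [X in (_ + X)%N]big_distrr -!big_split /=.
rewrite big_seq [RHS]big_seq.
apply: eq_bigr => q qs; rewrite muln2 (gcd_deg_second_difference p_irr i0) //.
exact: s_irr.
Qed.

Lemma elementary_divisors_nullity_gt0 n (A : 'M[F]_n) s p a :
  elementary_divisors A s -> monic_irreducible p -> (0 < a)%N ->
  p ^+ a \in s -> (0 < nullity A p)%N.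
Proof.
move=> As p_irr a0 pas; rewrite (elementary_divisors_nullity _ As).
rewrite (perm_big _ (perm_to_rem pas)) big_cons /= -{1}[p]expr1 addn_gt0.
rewrite gcd_deg_exp; last by case: p_irr.
by rewrite muln_gt0 monic_irreducible_gt0 //= leq_min a0.
Qed.

Lemma gcd_degreeE n f g p i :
  f \is monic -> (size f).-1 = n ->
  nullity (mxeval (companion n f) g) (p ^+ i) = gcd_degree f g p i.
Proof.
move=> f_mon <-; rewrite /nullity -mxeval_comp -/(nullity _ _).
by rewrite nullity_companion // /gcd_degree -rmorphXn.
Qed.

Lemma gcd_degree_gt0 f g p :
  f != 0 -> (0 < gcd_degree f g p 1)%N = ~~ coprimep (p \Po g) f.
Proof.
move=> f0; rewrite /gcd_degree expr1 coprimep_def.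
have : gcdp (p \Po g) f != 0 by rewrite gcdp_eq0 negb_and f0 orbT.
by rewrite -size_poly_gt0; case: size => [|[|k]].
Qed.

Lemma gcd_degree0 f g p : gcd_degree f g p 0 = 0%N.
Proof. by rewrite /gcd_degree expr0 (eqp_size (gcd1p _)) size_poly1. Qed.

(** The special value at 0 agrees with the general formula, as gcd(1, f) = 1. *)
Lemma gcd_ratioE f g p i :
  gcd_ratio f g p i = (gcd_degree f g p i)%:R / ((size p).-1)%:R.
Proof. by rewrite /gcd_ratio; case: eqP => // ->; rewrite gcd_degree0 mul0r. Qed.

Lemma elementary_divisor_minpoly n f g s p a :
  f \is monic -> (size f).-1 = n ->
  elementary_divisors (mxeval (companion n f) g) s ->
  monic_irreducible p -> (0 < a)%N -> p ^+ a \in s -> minpoly_set f g p.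
Proof.
move=> f_mon f_deg As p_irr a0 pas; have f0 := monic_neq0 f_mon.
apply/minpoly_setE => //; split=> //; rewrite -gcd_degree_gt0 //.
rewrite -(gcd_degreeE _ _ _ f_mon f_deg) expr1.
exact: elementary_divisors_nullity_gt0 As p_irr a0 pas.
Qed.

Lemma minpoly_setP n f g p : f \is monic -> (size f).-1 = n.+1 ->
  minpoly_set f g p <->
  monic_irreducible p /\ p %| mxminpoly (horner_mx (companion n.+1 f) g).
Proof.
move=> f_mon f_deg; have f0 := monic_neq0 f_mon.
set A := horner_mx _ _; set mu := mxminpoly A.
have dvd_mu y : (mu %| y) = (f %| y \Po g).
  by rewrite dvd_mxminpoly -(companion_dvd _ f_mon f_deg) mxeval_comp.
split=> [p_min|[p_irr p_mu]].
  have /minpoly_setE[//|p_irr _] := p_min; split=> //.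
  have [r [_ rf [_ pE]]] := p_min.
  by rewrite -pE (dvdp_trans rf) // -dvd_mu.
apply/minpoly_setE => //; split=> //; apply/negP=> cop.
have mu0 : mu != 0 by rewrite monic_neq0 // mxminpoly_monic.
have /dvdpP[q muE] := p_mu.
(* The minimal polynomial would divide its own proper factor q = mu / p. *)
have : mu %| q.
  have := dvdpp mu; rewrite {2}muE !dvd_mu comp_polyM Gauss_dvdpl //.
  by rewrite coprimep_sym.
have q0 : q != 0 by apply: contraNneq mu0 => q0; rewrite muE q0 mul0r.
move/(dvdp_leq q0); rewrite muE size_mul //; last exact: monic_irreducible_neq0.
case: p_irr => _ [+ _]; rewrite -size_poly_gt0 in q0.
by case: (size p) => [|[|k]] // _; rewrite !addnS /= -addSn -ltnS; lia.
Qed.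

End ElementaryDivisors.

Theorem theorem2p3 (F : fieldType) (n : nat) (f g : {poly F})
    (f_monic : f \is monic) (f_degree : (size f).-1 = n.+1) :
  let A := horner_mx (companion n.+1 f) g in
  [/\ forall (m : nat) (f' g' : {poly F}),
        f' \is monic -> (size f').-1 = m.+1 ->
        (forall p : {poly F}, minpoly_set f g p <-> minpoly_set f' g' p) ->
        (forall (p : {poly F}) (i : nat), minpoly_set f g p -> (0 < i)%N ->
           gcd_degree f g p i = gcd_degree f' g' p i) ->
        mx_similar A (horner_mx (companion m.+1 f') g'),
      forall p : {poly F},
        (monic_irreducible p /\ p %| mxminpoly A) <-> minpoly_set f g p,
      exists s : seq {poly F}, elementary_divisors A s
    & forall s : seq {poly F}, elementary_divisors A s ->
      forall (p : {poly F}) (i : nat), minpoly_set f g p -> (0 < i)%N ->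
        (count_mem (p ^+ i) s)%:R =
          2 * gcd_ratio f g p i - gcd_ratio f g p i.+1 - gcd_ratio f g p i.-1].
Proof.
move=> A; have f0 := monic_neq0 f_monic.
have count_eq m (h k : {poly F}) (s : seq {poly F}) (p : {poly F}) i :
    h \is monic -> (size h).-1 = m.+1 ->
    elementary_divisors (horner_mx (companion m.+1 h) k) s ->
    minpoly_set h k p -> (0 < i)%N ->
    ((gcd_degree h k p i).*2 = gcd_degree h k p i.+1 + gcd_degree h k p i.-1
      + (size p).-1 * count_mem (p ^+ i) s)%N.
  move=> h_mon h_deg hs hp i0; rewrite -!(gcd_degreeE _ _ _ h_mon h_deg).
  apply: elementary_divisors_count => //.
  by case/minpoly_setE: hp; rewrite ?monic_neq0.
split.
- move=> m f' g' f'_monic f'_degree eq_min eq_gcd.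
  have [s As] := elementary_divisors_exist A.
  have [t Bt] := elementary_divisors_exist (horner_mx (companion m.+1 f') g').
  have eq_count p i : minpoly_set f g p -> (0 < i)%N ->
      count_mem (p ^+ i) s = count_mem (p ^+ i) t.
    move=> fp i0; have f'p : minpoly_set f' g' p by apply/eq_min.
    have eq_gcd' j : gcd_degree f' g' p j = gcd_degree f g p j.
      by case: j => [|j]; [rewrite !gcd_degree0 | rewrite eq_gcd].
    have [/monic_irreducible_gt0 p_gt0 _] := (minpoly_setE g p f0).1 fp.
    apply/eqP; rewrite -(eqn_pmul2l p_gt0); apply/eqP.
    have := count_eq _ _ _ _ _ _ f_monic f_degree As fp i0.
    have := count_eq _ _ _ _ _ _ f'_monic f'_degree Bt f'p i0.
    by rewrite !eq_gcd' => -> /addnI.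
  have st : perm_eq s t.
    apply/allP=> q; rewrite mem_cat => qst; apply/eqP => /=.
    (* Every member of s or t is a power of some p in the common set P. *)
    have [p [a [a0 qE fp]]] :
        exists p a, [/\ (0 < a)%N, q = p ^+ a & minpoly_set f g p].
      case/orP: qst => [qs|qt].
        have [p [a [p_irr a0 qE]]] := As.1 q qs; exists p, a; split=> //.
        apply: (elementary_divisor_minpoly f_monic f_degree As p_irr a0).
        by rewrite -qE.
      have [p [a [p_irr a0 qE]]] := Bt.1 q qt; exists p, a; split=> //.
      apply/eq_min.
      apply: (elementary_divisor_minpoly f'_monic f'_degree Bt p_irr a0).
      by rewrite -qE.
    by rewrite qE eq_count.
  apply: mx_similar_trans As.2 _.
  exact: mx_similar_trans (companion_sum_perm st) (mx_similar_sym Bt.2).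
- by move=> p; split=> /(minpoly_setP g p f_monic f_degree).
- exact: elementary_divisors_exist.
move=> s As p i fp i0; rewrite !gcd_ratioE.
have [/monic_irreducible_gt0 p_gt0 _] := (minpoly_setE g p f0).1 fp.
have p_neq0 : ((size p).-1)%:R != 0 :> rat by rewrite pnatr_eq0 -lt0n.
have := congr1 (fun k => k%:R : rat)
  (count_eq _ _ _ _ _ _ f_monic f_degree As fp i0).
rewrite -muln2 !natrD !natrM => E.
transitivity (((gcd_degree f g p i)%:R * 2 - (gcd_degree f g p i.+1)%:R
    - (gcd_degree f g p i.-1)%:R) / ((size p).-1)%:R : rat).
  by rewrite E; field.
by field.
Qed.
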